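(* Let $f:\mathbb{R}\to\mathbb{R}$ be a continuous, 1-periodic, translation-even function (with shift $\sigma\in(0,1)$). Then for any continuous function $\varphi:\mathbb{R}\to\mathbb{R}$, $$\big\langle(\varphi\circ f)\cdot[\![f]\!]\big\rangle=0 .$$
   Context: For a continuous 1-periodic function $g:\mathbb{R}\to\mathbb{R}$ (i.e. $g(y+1)=g(y)$ for all $y$) define its average over one period $\langle g\rangle:=\int_0^1 g(y)\,dy$, its fluctuating part $\{g\}(y):=g(y)-\langle g\rangle$, and, for all $y\in\mathbb{R}$, $$[\![g]\!](y):=\int_0^y\{g\}(\xi)\,d\xi-\int_0^1\int_0^\tau\{g\}(\xi)\,d\xi\,d\tau .$$ A 1-periodic function $f$ is called translation-even with shift $\sigma\in(0,1)$ if the shifted function $f_\sigma(y):=f(y-\sigma)$ is even with respect to the midpoint of $[0,1]$, i.e. $f_\sigma(y)=f_\sigma(1-y)$ for all $y\in[0,1]$; $f$ is translation-even if such a $\sigma\in(0,1)$ exists. *)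

(* Defs.v *)
From Stdlib Require Import Reals.
From Coquelicot Require Import Coquelicot.
Open Scope R_scope.

(** [RInt] is total, and returns a junk value on a function that is not
    Riemann integrable; below it is meant for continuous integrands. *)
Definition average (g : R -> R) : R := RInt g 0 1.

Definition fluct (g : R -> R) (y : R) : R := g y - average g.

(** The zero-average antiderivative of [fluct g]. *)
Definition bracket (g : R -> R) (y : R) : R :=
  RInt (fluct g) 0 y - RInt (fun tau => RInt (fluct g) 0 tau) 0 1.

Definition periodic1 (g : R -> R) : Prop := forall y, g (y + 1) = g y.

Definition translate (sigma : R) (f : R -> R) (y : R) : R := f (y - sigma).

Definition translation_even_with (sigma : R) (f : R -> R) : Prop :=
  forall y, 0 <= y <= 1 -> translate sigma f y = translate sigma f (1 - y).

Definition translation_even (f : R -> R) : Prop :=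
  exists sigma, 0 < sigma < 1 /\ translation_even_with sigma f.

(* Main.v *)
Require Import Defs.
From Stdlib Require Import Reals Lra ZArith.
From Coquelicot Require Import Coquelicot.
Open Scope R_scope.

(** Extended by periodicity, translation-evenness says that [f] is symmetric
    under a reflection [x |-> c - x] of the line. The fluctuating part of [f]
    has the same symmetry, so [bracket f x + bracket f (c - x)] does not depend
    on [x]; as [bracket f] is periodic with average zero, this constant is zero.
    Hence [phi (f x) * bracket f x] is periodic and odd under the reflection,
    and its average over a period equals its own opposite. *)

Lemma ex_RInt_everywhere_continuous (h : R -> R) (a b : R) :
  (forall x, continuous h x) -> ex_RInt h a b.
Proof.
  intros Hh. apply (ex_RInt_continuous (V := R_CompleteNormedModule)).
  intros; apply Hh.
Qed.

Lemma RInt_shift (h : R -> R) (v a b : R) :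
  (forall x, continuous h x) ->
  RInt (fun x => h (x + v)) a b = RInt h (a + v) (b + v).
Proof.
  intros Hh.
  replace (a + v) with (1 * a + v) by ring.
  replace (b + v) with (1 * b + v) by ring.
  rewrite <- (RInt_comp_lin (V := R_CompleteNormedModule) h)
    by now apply ex_RInt_everywhere_continuous.
  apply RInt_ext. intros x _.
  change (h (x + v) = 1 * h (1 * x + v)).
  now rewrite !Rmult_1_l.
Qed.

Lemma RInt_reflect (h : R -> R) (c a b : R) :
  (forall x, continuous h x) ->
  RInt (fun x => h (c - x)) a b = RInt h (c - b) (c - a).
Proof.
  intros Hh.
  (* The sign from exchanging the bounds cancels the slope -1 of the substitution [-1 * x + c]. *)
  rewrite <- (opp_RInt_swap (V := R_CompleteNormedModule) h)
    by now apply ex_RInt_everywhere_continuous.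
  replace (c - a) with ((-1) * a + c) by ring.
  replace (c - b) with ((-1) * b + c) by ring.
  rewrite <- (RInt_comp_lin (V := R_CompleteNormedModule) h)
    by now apply ex_RInt_everywhere_continuous.
  rewrite <- (RInt_opp (V := R_CompleteNormedModule)).
  - apply RInt_ext. intros x _.
    change (h (c - x) = - (-1 * h (-1 * x + c))).
    replace (-1 * x + c) with (c - x) by ring. ring.
  - apply (ex_RInt_comp_lin (V := R_NormedModule) h).
    now apply ex_RInt_everywhere_continuous.
Qed.

Lemma RInt_Chasles_continuous (h : R -> R) (a b c : R) :
  (forall x, continuous h x) -> RInt h a b + RInt h b c = RInt h a c.
Proof.
  intros Hh.
  apply (RInt_Chasles (V := R_CompleteNormedModule));
    now apply ex_RInt_everywhere_continuous.
Qed.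

(** Shifting by one period identifies the integrals over [0, a] and [1, a + 1]; splitting the
    integral over [0, a + 1] at [a] and at 1 then leaves equal remainders. *)
Lemma RInt_period (h : R -> R) (a : R) :
  (forall x, continuous h x) -> periodic1 h -> RInt h a (a + 1) = average h.
Proof.
  intros Hh Hp.
  assert (E : RInt h 0 a = RInt h 1 (a + 1)).
  { replace 1 with (0 + 1) at 1 by ring.
    rewrite <- RInt_shift by assumption.
    apply RInt_ext. intros x _. now rewrite Hp. }
  pose proof (RInt_Chasles_continuous h 0 a (a + 1) Hh).
  pose proof (RInt_Chasles_continuous h 0 1 (a + 1) Hh).
  unfold average. lra.
Qed.

(** The reflection carries [0, 1] to [c - 1, c], which is again a full period. *)
Lemma average_reflect (h : R -> R) (c : R) :
  (forall x, continuous h x) -> periodic1 h ->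
  average (fun x => h (c - x)) = average h.
Proof.
  intros Hh Hp. unfold average at 1.
  rewrite RInt_reflect by assumption.
  rewrite <- (RInt_period h (c - 1)) by assumption.
  f_equal; ring.
Qed.

Lemma average_odd_reflection (h : R -> R) (c : R) :
  (forall x, continuous h x) -> periodic1 h ->
  (forall x, h (c - x) = - h x) -> average h = 0.
Proof.
  intros Hh Hp Hodd.
  assert (E : average h = - average h); [|lra].
  rewrite <- (average_reflect h c) at 1 by assumption.
  unfold average.
  rewrite <- (RInt_opp (V := R_CompleteNormedModule))
    by now apply ex_RInt_everywhere_continuous.
  apply RInt_ext. intros x _. apply Hodd.
Qed.

Lemma average_minus_const (h : R -> R) (k : R) :
  (forall x, continuous h x) -> average (fun x => h x - k) = average h - k.
Proof.
  intros Hh. unfold average.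
  rewrite (RInt_minus (V := R_CompleteNormedModule) h (fun _ => k)).
  - rewrite (RInt_const (V := R_CompleteNormedModule)).
    change (RInt h 0 1 - (1 - 0) * k = RInt h 0 1 - k). ring.
  - now apply ex_RInt_everywhere_continuous.
  - apply (ex_RInt_const (V := R_NormedModule)).
Qed.

Lemma periodic1_IZR (f : R -> R) (n : Z) (x : R) :
  periodic1 f -> f (x + IZR n) = f x.
Proof.
  intros Hp. revert x.
  induction n using Z.peano_ind; intros x.
  - now rewrite Rplus_0_r.
  - unfold Z.succ. rewrite plus_IZR, <- Rplus_assoc, Hp. apply IHn.
  (* Going down, one period is added first, which turns the predecessor back into [n]. *)
  - rewrite <- Hp. rewrite <- (IHn x). f_equal.
    unfold Z.pred. rewrite plus_IZR. ring.
Qed.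

(** With [x = y - sigma], the reflection [y |-> 1 - y] becomes [x |-> 1 - 2 * sigma - x].
    Periodicity extends the symmetry from one period to the whole line. *)
Lemma translation_even_reflection (f : R -> R) (sigma x : R) :
  periodic1 f -> translation_even_with sigma f ->
  f (1 - 2 * sigma - x) = f x.
Proof.
  intros Hp He.
  (* Removing [n] periods brings [x + sigma] into [0, 1], where the hypothesis applies. *)
  set (n := Int_part (x + sigma)).
  destruct (base_Int_part (x + sigma)) as [H1 H2]. fold n in H1, H2.
  assert (Hy : 0 <= x + sigma - IZR n <= 1) by lra.
  apply He in Hy. unfold translate in Hy.
  rewrite <- (periodic1_IZR f n (1 - 2 * sigma - x)) by assumption.
  rewrite <- (periodic1_IZR f n (x + sigma - IZR n - sigma)) in Hy by assumption.
  replace (x + sigma - IZR n - sigma + IZR n) with x in Hy by ring.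
  rewrite Hy. f_equal. ring.
Qed.

Lemma continuous_fluct (f : R -> R) :
  (forall x, continuous f x) -> forall x, continuous (fluct f) x.
Proof.
  intros Hf x. apply (continuous_minus (V := R_NormedModule) f).
  - apply Hf.
  - apply continuous_const.
Qed.

Lemma continuous_primitive (h : R -> R) (a : R) :
  (forall x, continuous h x) -> forall x, continuous (fun y => RInt h a y) x.
Proof.
  intros Hh x. apply (continuous_RInt_1 (V := R_NormedModule) h a x).
  exists (mkposreal 1 Rlt_0_1). intros z _.
  apply (RInt_correct (V := R_CompleteNormedModule)).
  now apply ex_RInt_everywhere_continuous.
Qed.

Lemma continuous_bracket (f : R -> R) :
  (forall x, continuous f x) -> forall x, continuous (bracket f) x.
Proof.
  intros Hf x.
  apply (continuous_minus (V := R_NormedModule) (fun y => RInt (fluct f) 0 y)).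
  - now apply continuous_primitive, continuous_fluct.
  - apply continuous_const.
Qed.

Lemma average_fluct (f : R -> R) :
  (forall x, continuous f x) -> average (fluct f) = 0.
Proof.
  intros Hf. unfold fluct. rewrite (average_minus_const f) by assumption. ring.
Qed.

Lemma average_bracket (f : R -> R) :
  (forall x, continuous f x) -> average (bracket f) = 0.
Proof.
  intros Hf. unfold bracket. rewrite average_minus_const.
  (* The constant subtracted in [bracket] is by definition the average of the primitive. *)
  - now apply Rminus_diag_eq.
  - now apply continuous_primitive, continuous_fluct.
Qed.

(** The increment over a period is the integral of [fluct f] over that period, hence the zero
    average of [fluct f]. *)
Lemma periodic1_bracket (f : R -> R) :
  (forall x, continuous f x) -> periodic1 f -> periodic1 (bracket f).
Proof.
  intros Hf Hp y.
  pose proof (continuous_fluct f Hf) as Hc.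
  assert (P : periodic1 (fluct f)) by (intros x; unfold fluct; now rewrite Hp).
  pose proof (RInt_Chasles_continuous (fluct f) 0 y (y + 1) Hc) as HC.
  rewrite RInt_period, average_fluct in HC by assumption.
  unfold bracket. lra.
Qed.

Lemma bracket_reflection (f : R -> R) (c : R) :
  (forall x, continuous f x) -> periodic1 f -> (forall x, f (c - x) = f x) ->
  forall x, bracket f (c - x) = - bracket f x.
Proof.
  intros Hf Hp Hs.
  pose proof (continuous_fluct f Hf) as Hc.
  pose proof (continuous_bracket f Hf) as Hb.
  assert (K : exists k, forall x, bracket f (c - x) = - (bracket f x - k)).
  (* This is the constant value of [bracket f x + bracket f (c - x)]: the two primitives add up to
     the integral from 0 to [c], and each bracket subtracts the average once. *)
  { exists (RInt (fluct f) 0 c - 2 * average (fun tau => RInt (fluct f) 0 tau)).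
    intros x.
    (* The substitution [u |-> c - u] exchanges the two intervals and preserves [fluct f]. *)
    assert (E : RInt (fluct f) (c - x) c = RInt (fluct f) 0 x).
    { replace c with (c - 0) at 2 by ring.
      rewrite <- RInt_reflect by assumption.
      apply RInt_ext. intros u _. unfold fluct. now rewrite Hs. }
    pose proof (RInt_Chasles_continuous (fluct f) 0 (c - x) c Hc).
    unfold bracket, average. lra. }
  destruct K as [k K].
  (* Averaging [K] over a period gives 0 on the left, by reflection invariance of the average, and
     [k] on the right. *)
  assert (k0 : k = 0).
  { pose proof (average_reflect (bracket f) c Hb (periodic1_bracket f Hf Hp)) as A.
    rewrite average_bracket in A by assumption.
    assert (B : average (fun x => bracket f (c - x))
                = - average (fun x => bracket f x - k)).
    { unfold average. rewrite <- (RInt_opp (V := R_CompleteNormedModule)).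
      - apply RInt_ext. intros x _. apply K.
      - apply ex_RInt_everywhere_continuous. intros x.
        apply (continuous_minus (V := R_NormedModule) (bracket f)).
        + apply Hb.
        + apply continuous_const. }
    rewrite (average_minus_const (bracket f)) in B by assumption.
    rewrite average_bracket in B by assumption. lra. }
  intros x. rewrite K, k0. ring.
Qed.

Theorem proposition5 (f : R -> R)
  (f_cont : forall y, continuous f y)
  (f_per : periodic1 f)
  (f_even : translation_even f)
  (phi : R -> R)
  (phi_cont : forall z, continuous phi z) :
  average (fun y => phi (f y) * bracket f y) = 0.
Proof.
  destruct f_even as [sigma [_ f_even]].
  pose proof (fun x => translation_even_reflection f sigma x f_per f_even) as Hs.
  apply (average_odd_reflection _ (1 - 2 * sigma)).
  - intros x.
    apply (continuous_mult (K := R_AbsRing) (fun y => phi (f y)) (bracket f)).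
    + now apply continuous_comp.
    + now apply continuous_bracket.
  - intros y. now rewrite f_per, periodic1_bracket.
  - intros x. rewrite Hs, bracket_reflection by assumption. ring.
Qed.
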